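(* Let $m\ge1$, let $\delta_1=0$ and let $\delta_2,\dots,\delta_m\in\mathbb{C}$ satisfy $0=|\delta_1|<|\delta_2|<\cdots<|\delta_m|$. Let $$x_1(w)=\frac1w+\sum_{j=2}^m\frac1{w-\delta_j},$$ and for $n\in\{1,\dots,m\}$ let $A_n=\{w\in\mathbb{C}:|\delta_n|<|w|<|\delta_{n+1}|\}$, with $|\delta_{m+1}|=\infty$. Then on each annulus $A_n$ the function $x_1(w)$ admits a Laurent expansion $$x_1(w)=\frac nw+H_n(w),$$ where $H_n(w)$ is holomorphic on $A_n$ and has the explicit expansion $$H_n(w)=\sum_{j\in I_{\rm in}(n)}\sum_{k=1}^\infty\frac{\delta_j^k}{w^{k+1}}-\sum_{j\in I_{\rm out}(n)}\sum_{k=0}^\infty\frac{w^k}{\delta_j^{k+1}} .$$ In particular, the coefficient of $w^{-1}$ is exactly $n=1+|I_{\rm in}(n)|$.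
   Context: For $w\in A_n$ the index sets are $$I_{\rm in}(n)=\{j\in\{2,\dots,m\}:|\delta_j|<|w|\},\qquad I_{\rm out}(n)=\{j\in\{2,\dots,m\}:|\delta_j|>|w|\};$$ they do not depend on the choice of $w\in A_n$. The function $x_1$ is the first component of the general solution $x_1=\sum_{j=1}^m 1/(z_1-t_j)$ of the autonomous Riccati hierarchy with distinct poles $t_j$, written in the shifted variable $w=z_1-t_1$ with $\delta_j=t_j-t_1$. *)

(* Defs.v *)
From Stdlib Require Export Reals ZArith List.
From Coquelicot Require Export Coquelicot.

Open Scope C_scope.

Definition Csum (l : list nat) (f : nat -> C) : C :=
  fold_right (fun j s => f j + s) 0 l.

(** The points are indexed from 1: only [delta 1], ..., [delta m] are ever
    used, and [seq 2 (m - 1)] is the list 2, ..., m (empty when [m = 1]). *)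
Definition x1 (m : nat) (delta : nat -> C) (w : C) : C :=
  1 / w + Csum (seq 2 (m - 1)) (fun j => 1 / (w - delta j)).

(** The radius [|delta_n|], with the convention [|delta_(m+1)| = oo]. *)
Definition radius (m : nat) (delta : nat -> C) (n : nat) : Rbar :=
  if (n <=? m)%nat then Finite (Cmod (delta n)) else p_infty.

Definition annulus (m : nat) (delta : nat -> C) (n : nat) (w : C) : Prop :=
  Rbar_lt (radius m delta n) (Cmod w) /\
  Rbar_lt (Cmod w) (radius m delta (S n)).

Definition Rltb (x y : R) : bool := if Rlt_dec x y then true else false.

(** The index sets attached to a point [w], as duplicate-free increasing
    lists, so that equality of lists is equality of sets and [length] is the
    cardinality. *)
Definition I_in (m : nat) (delta : nat -> C) (w : C) : list nat :=
  filter (fun j => Rltb (Cmod (delta j)) (Cmod w)) (seq 2 (m - 1)).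

Definition I_out (m : nat) (delta : nat -> C) (w : C) : list nat :=
  filter (fun j => Rltb (Cmod w) (Cmod (delta j))) (seq 2 (m - 1)).

(** Used for open sets [A], on which this is the usual notion. *)
Definition holomorphic_on (A : C -> Prop) (f : C -> C) : Prop :=
  forall w, A w -> ex_derive (K := C_AbsRing) (V := C_NormedModule) f w.

Definition is_Cseries (a : nat -> C) (s : C) : Prop :=
  is_series (K := C_AbsRing) (V := C_NormedModule) a s.

(** [h] is the value at [w] of
    [sum_(j in Iin) sum_(k >= 1) delta_j^k / w^(k+1)
     - sum_(j in Iout) sum_(k >= 0) w^k / delta_j^(k+1)],
    all the series being convergent; the first inner sum is shifted so as to
    start at [k = 0]. *)
Definition H_expansion (delta : nat -> C) (Iin Iout : list nat) (w h : C) :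
    Prop :=
  exists S_in S_out : nat -> C,
    (forall j, In j Iin ->
       is_Cseries (fun k => delta j ^ (k + 1) / w ^ (k + 2)) (S_in j)) /\
    (forall j, In j Iout ->
       is_Cseries (fun k => w ^ k / delta j ^ (k + 1)) (S_out j)) /\
    h = Csum Iin S_in - Csum Iout S_out.

(** [f w = sum_(k in Z) a_k w^k] on [A], the nonnegative and the negative
    parts converging separately. *)
Definition laurent_expansion (A : C -> Prop) (f : C -> C) (a : Z -> C) :
    Prop :=
  forall w, A w ->
    exists p q : C,
      is_Cseries (fun k => a (Z.of_nat k) * w ^ k) p /\
      is_Cseries (fun k => a (- Z.of_nat (k + 1))%Z / w ^ (k + 1)) q /\
      f w = p + q.

(* Main.v *)
Require Import Defs.
From Stdlib Require Import Lia Lra Psatz.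

(** On the annulus [A_n] the poles [delta_1, ..., delta_n] lie strictly inside
    the circle through [w] and the remaining ones strictly outside, so each
    summand of [x1] expands as a geometric series: in [delta_j / w] for an inner
    pole, in [w / delta_j] for an outer one ([is_Cseries_inv_minus], used with
    the two arguments in either order). Every inner pole, [delta_1 = 0]
    included, contributes exactly one [1 / w]. Taking these [n] leading terms
    out leaves [H_n]; collecting equal powers of [w] over the poles gives a
    Laurent expansion of [x1] whose coefficient of [1 / w] is
    [sum_(j <= n) delta_j ^ 0 = n] ([x1_laurent_expansion]).

    It remains to see that the coefficient of [1 / w] depends only on the
    function ([laurent_residue_unique]). The contour integral that computes a
    residue is replaced by its Riemann sums: the mean of [w * f w] over the
    points [r * zeta ^ l], where [zeta] is a primitive root of unity of order
    [K + 1]. Such a mean kills every power [w ^ k] with [0 < |k| <= K], so on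
    the Laurent series truncated at [K] terms on each side it returns exactly
    [a (-1)]. Convergence at one point of larger and one of smaller modulus than
    [r] bounds the omitted tails by geometric sequences, uniformly on the circle
    [|w| = r]. Hence the means tend to [a (-1)] ([circle_mean_residue]), and a
    limit is unique. *)

(** * Finite sums of complex numbers *)

Lemma Csum_ext_in (l : list nat) (f g : nat -> C) :
  (forall j, In j l -> f j = g j) -> Csum l f = Csum l g.
Proof.
  induction l as [|i l IH]; intros E; simpl; [reflexivity|].
  rewrite E by now left.
  now rewrite IH by (intros j Hj; apply E; now right).
Qed.

Lemma Csum_app (l l' : list nat) (f : nat -> C) :
  Csum (l ++ l') f = Csum l f + Csum l' f.
Proof. induction l as [|i l IH]; simpl; [|rewrite IH]; ring. Qed.

Lemma Csum_seq_S (n : nat) (f : nat -> C) :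
  Csum (seq 0 (S n)) f = Csum (seq 0 n) f + f n.
Proof. rewrite seq_S, Csum_app. simpl. ring. Qed.

Lemma Csum_plus (l : list nat) (f g : nat -> C) :
  Csum l (fun j => f j + g j) = Csum l f + Csum l g.
Proof. induction l as [|i l IH]; simpl; [|rewrite IH]; ring. Qed.

Lemma Csum_mult_l (l : list nat) (c : C) (f : nat -> C) :
  Csum l (fun j => c * f j) = c * Csum l f.
Proof. induction l as [|i l IH]; simpl; [|rewrite IH]; ring. Qed.

Lemma Csum_const (l : list nat) (c : C) :
  Csum l (fun _ => c) = INR (length l) * c.
Proof.
  induction l as [|i l IH]; [simpl; ring|].
  change (length (i :: l)) with (S (length l)).
  rewrite S_INR, RtoC_plus. simpl Csum. rewrite IH. ring.
Qed.

Lemma Csum_exchange (l l' : list nat) (f : nat -> nat -> C) :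
  Csum l (fun i => Csum l' (fun j => f i j)) =
  Csum l' (fun j => Csum l (fun i => f i j)).
Proof.
  induction l as [|i l IH]; simpl.
  - rewrite Csum_const. ring.
  - now rewrite IH, Csum_plus.
Qed.

Lemma Cmod_Csum_le (l : list nat) (f : nat -> C) (M : R) :
  (forall j, In j l -> (Cmod (f j) <= M)%R) ->
  (Cmod (Csum l f) <= INR (length l) * M)%R.
Proof.
  induction l as [|i l IH]; intros B.
  - simpl. rewrite Cmod_0. lra.
  - change (length (i :: l)) with (S (length l)).
    rewrite S_INR. simpl Csum.
    pose proof (Cmod_triangle (f i) (Csum l f)).
    specialize (IH (fun j Hj => B j (or_intror Hj))).
    specialize (B i (or_introl eq_refl)). lra.
Qed.

Lemma sum_n_Csum (a : nat -> C) (n : nat) :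
  sum_n (G := C_NormedModule) a n = Csum (seq 0 (S n)) a.
Proof.
  induction n as [|n IH].
  - rewrite sum_O. simpl. ring.
  - rewrite sum_Sn, IH, (Csum_seq_S (S n)). reflexivity.
Qed.

Lemma geometric_Csum (z : C) (n : nat) :
  1 - z <> 0 -> Csum (seq 0 n) (fun k => z ^ k) = (1 - z ^ n) / (1 - z).
Proof.
  intros Z. induction n as [|n IH]; [simpl; field; exact Z|].
  rewrite Csum_seq_S, IH, Cpow_S. field. exact Z.
Qed.

(** * Convergent complex series *)

Lemma filterlim_C_squeeze (u : nat -> C) (l : C) (e : nat -> R) :
  eventually (fun n => (Cmod (u n - l) <= e n)%R) -> is_lim_seq e 0 ->
  filterlim u eventually (locally (T := C_NormedModule) l).
Proof.
  intros B L.
  apply (filterlim_locally_ball_norm (K := C_AbsRing) (U := C_NormedModule)).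
  intros eps.
  apply is_lim_seq_spec in L. specialize (L eps).
  generalize (filter_and _ _ B L). apply filter_imp. intros n [H1 H2].
  unfold ball_norm. change (Cmod (u n - l) < eps)%R.
  rewrite Rminus_0_r in H2.
  pose proof (Rle_abs (e n)). lra.
Qed.

Lemma is_Cseries_ext (a b : nat -> C) (s t : C) :
  (forall k, a k = b k) -> s = t -> is_Cseries a s -> is_Cseries b t.
Proof. intros E -> H. exact (is_series_ext a b t E H). Qed.

Lemma is_Cseries_mult_l (c : C) (a : nat -> C) (s : C) :
  is_Cseries a s -> is_Cseries (fun k => c * a k) (c * s).
Proof.
  exact (is_series_scal (K := C_AbsRing) (V := C_NormedModule) c a s).
Qed.

Lemma is_Cseries_Csum (l : list nat) (a : nat -> nat -> C) (s : nat -> C) :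
  (forall j, In j l -> is_Cseries (a j) (s j)) ->
  is_Cseries (fun k => Csum l (fun j => a j k)) (Csum l s).
Proof.
  induction l as [|i l IH]; intros H; simpl.
  - apply is_Cseries_ext with (fun _ => 0 * 0) (0 * 0); [intros; ring|ring|].
    apply is_Cseries_mult_l.
    apply (filterlim_C_squeeze _ _ (fun _ => 0%R)); [|apply is_lim_seq_const].
    exists O. intros n _. rewrite sum_n_Csum, Csum_const.
    replace (_ - _) with (RtoC 0) by ring. rewrite Cmod_0. lra.
  - apply (is_series_plus (K := C_AbsRing) (V := C_NormedModule)).
    + apply H. now left.
    + apply IH. intros j Hj. apply H. now right.
Qed.

Lemma is_Cseries_geometric (z : C) :
  (Cmod z < 1)%R -> is_Cseries (fun k => z ^ k) (1 / (1 - z)).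
Proof.
  intros Hz.
  assert (Z : 1 - z <> 0).
  { intros E. assert (z = 1) as -> by (rewrite <- (Cplus_0_l z), <- E; ring).
    rewrite Cmod_1 in Hz. lra. }
  apply (filterlim_C_squeeze _ _
           (fun n => (/ Cmod (1 - z) * Cmod z ^ S n)%R)).
  - exists O. intros n _. rewrite sum_n_Csum.
    replace (Csum _ _ - _) with (/ (1 - z) * - (z ^ S n)).
    + rewrite Cmod_mult, Cmod_inv, Cmod_opp, Cmod_pow by exact Z. lra.
    + rewrite geometric_Csum by exact Z. field. exact Z.
  - replace (Finite 0) with (Rbar_mult (/ Cmod (1 - z))%R 0%R)
      by (simpl; f_equal; ring).
    apply is_lim_seq_scal_l.
    apply (is_lim_seq_incr_1 (fun n => (Cmod z ^ n)%R)).
    apply is_lim_seq_geom. rewrite Rabs_pos_eq by apply Cmod_ge_0. exact Hz.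
Qed.

Lemma Cmod_lt_neq (x y : C) : (Cmod x < Cmod y)%R -> y - x <> 0.
Proof.
  intros H E. assert (y = x) as -> by (rewrite <- (Cplus_0_l x), <- E; ring).
  lra.
Qed.

Lemma Cmod_lt_neq_0 (x y : C) : (Cmod x < Cmod y)%R -> y <> 0.
Proof. intros H ->. rewrite Cmod_0 in H. pose proof (Cmod_ge_0 x). lra. Qed.

(** Both geometric expansions of a simple pole are instances: [x] is the pole
    and [y] the variable for an inner pole, the other way round for an outer
    one. *)
Lemma is_Cseries_inv_minus (x y : C) :
  (Cmod x < Cmod y)%R ->
  is_Cseries (fun k => x ^ k / y ^ (k + 1)) (1 / (y - x)).
Proof.
  intros H.
  pose proof (Cmod_lt_neq x y H) as N. pose proof (Cmod_lt_neq_0 x y H) as Y.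
  apply is_Cseries_ext with
    (fun k => / y * (x / y) ^ k) (/ y * (1 / (1 - x / y))).
  - intros k. unfold Cdiv at 1. rewrite Cpow_mult_l, Cpow_inv by exact Y.
    rewrite Cpow_add_r, Cpow_1_r. field. split; [exact Y|now apply Cpow_nz].
  - field. now split.
  - apply is_Cseries_mult_l, is_Cseries_geometric.
    rewrite Cmod_div by exact Y. apply Rlt_div_l; [|lra].
    now apply Cmod_gt_0.
Qed.

(** The expansion of an inner pole with its leading term [1 / y] removed is the
    same series multiplied by [x / y]. *)
Lemma is_Cseries_inv_minus_tail (x y : C) :
  (Cmod x < Cmod y)%R ->
  is_Cseries (fun k => x ^ (k + 1) / y ^ (k + 2)) (1 / (y - x) - 1 / y).
Proof.
  intros H.
  pose proof (Cmod_lt_neq x y H) as N. pose proof (Cmod_lt_neq_0 x y H) as Y.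
  apply is_Cseries_ext with
    (fun k => x / y * (x ^ k / y ^ (k + 1))) (x / y * (1 / (y - x))).
  - intros k. rewrite !Cpow_add_r. replace (y ^ 2) with (y * y) by (simpl; ring).
    rewrite !Cpow_1_r. field. split; [exact Y|now apply Cpow_nz].
  - field. now split.
  - apply is_Cseries_mult_l. now apply is_Cseries_inv_minus.
Qed.

(** * Complex derivative of the inverse *)

Lemma is_derive_Cinv (w : C) :
  w <> 0 ->
  is_derive (K := C_AbsRing) (V := C_NormedModule) Cinv w (- / (w * w)).
Proof.
  intros W. split; [apply is_linear_scal_l|].
  intros x Hx.
  apply (is_filter_lim_locally_unique (K := C_AbsRing)
           (V := AbsRing_NormedModule C_AbsRing)) in Hx. subst x.
  intros eps.
  pose proof (proj1 (Cmod_gt_0 w) W) as P.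
  (* The remainder of the linear approximation is exactly
     (y - w)^2 / (y w^2). The first bound on d keeps |y| >= |w| / 2, and the
     second then makes the remainder at most eps |y - w|. *)
  set (d := Rmin (Cmod w / 2) (eps * Cmod w ^ 3 / 2)).
  assert (D : (0 < d)%R).
  { apply Rmin_glb_lt; [lra|]. pose proof (cond_pos eps).
    assert (0 < Cmod w ^ 3)%R by now apply pow_lt. nra. }
  exists (mkposreal d D). intros y Hy. change C in y.
  change (Cmod (y - w) < d)%R in Hy.
  change (Cmod (/ y - / w - (y - w) * - / (w * w)) <= eps * Cmod (y - w))%R.
  pose proof (Rmin_l (Cmod w / 2) (eps * Cmod w ^ 3 / 2)) as D1.
  pose proof (Rmin_r (Cmod w / 2) (eps * Cmod w ^ 3 / 2)) as D2.
  fold d in D1, D2.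
  assert (Y2 : (Cmod w / 2 <= Cmod y)%R).
  { pose proof (Cmod_triangle y (- (y - w))) as T. rewrite Cmod_opp in T.
    replace (y + - (y - w)) with w in T by ring. lra. }
  assert (Y : y <> 0) by (apply Cmod_gt_0; lra).
  replace (/ y - / w - (y - w) * - / (w * w))
    with ((y - w) * (y - w) / (y * (w * w))) by (field; now split).
  rewrite Cmod_div by (repeat apply Cmult_neq_0; assumption).
  rewrite !Cmod_mult.
  pose proof (Cmod_ge_0 (y - w)).
  apply Rle_div_l; [apply Rmult_lt_0_compat; nra|].
  replace (eps * Cmod (y - w) * (Cmod y * (Cmod w * Cmod w)))%R
    with (eps * (Cmod w * Cmod w) * Cmod y * Cmod (y - w))%R by ring.
  apply Rmult_le_compat_r; [lra|].
  apply Rle_trans with (eps * Cmod w ^ 3 / 2)%R; [lra|].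
  replace (eps * Cmod w ^ 3 / 2)%R
    with (eps * (Cmod w * Cmod w) * (Cmod w / 2))%R by (simpl; field).
  apply Rmult_le_compat_l; [|exact Y2].
  pose proof (cond_pos eps). nra.
Qed.

(** * Tails of power series *)

Lemma is_Cseries_bounded (a : nat -> C) (s : C) :
  is_Cseries a s -> exists M : R, forall k, (Cmod (a k) <= M)%R.
Proof.
  intros H.
  destruct (filterlim_bounded (K := C_AbsRing) (V := C_NormedModule)
              (sum_n (G := C_NormedModule) a) (ex_intro _ s H)) as [B HB].
  assert (HB' : forall n, (Cmod (Csum (seq 0 (S n)) a) <= B)%R).
  { intros n. rewrite <- sum_n_Csum. exact (HB n). }
  exists (B + B)%R. intros k.
  pose proof (HB' k) as H1. rewrite Csum_seq_S in H1.
  assert (H0 : (Cmod (Csum (seq 0 k) a) <= B)%R).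
  { destruct k as [|k]; [|exact (HB' k)].
    change (Csum (seq 0 0) a) with (RtoC 0). rewrite Cmod_0.
    pose proof (HB' 0%nat). pose proof (Cmod_ge_0 (Csum (seq 0 1) a)). lra. }
  pose proof (Cmod_triangle (Csum (seq 0 k) a + a k) (- Csum (seq 0 k) a)) as T.
  rewrite Cmod_opp in T.
  replace (Csum (seq 0 k) a + a k + - Csum (seq 0 k) a) with (a k) in T by ring.
  lra.
Qed.

Lemma is_Cseries_geometric_tail (c : nat -> C) (s : C) (M q : R) (K : nat) :
  (0 <= q < 1)%R -> (forall k, (Cmod (c k) <= M * q ^ k)%R) ->
  is_Cseries c s ->
  (Cmod (s - Csum (seq 0 K) c) <= M / (1 - q) * q ^ K)%R.
Proof.
  intros Q B H.
  assert (M0 : (0 <= M)%R).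
  { pose proof (B 0%nat). pose proof (Cmod_ge_0 (c 0%nat)). simpl in *. lra. }
  (* Keeping the exact geometric sum in the bound, rather than its limit, is
     what makes the induction go through. *)
  assert (P : forall n,
    (Cmod (Csum (seq 0 (n + K)) c - Csum (seq 0 K) c)
       <= M / (1 - q) * (q ^ K - q ^ (n + K)))%R).
  { induction n as [|n IH].
    - change (0 + K)%nat with K.
      replace (Csum (seq 0 K) c - Csum (seq 0 K) c) with (RtoC 0) by ring.
      rewrite Cmod_0.
      right. field. lra.
    - change (S n + K)%nat with (S (n + K)). rewrite Csum_seq_S.
      replace (Csum (seq 0 (n + K)) c + c (n + K)%nat - Csum (seq 0 K) c)
        with (Csum (seq 0 (n + K)) c - Csum (seq 0 K) c + c (n + K)%nat)
        by ring.
      eapply Rle_trans; [apply Cmod_triangle|].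
      eapply Rle_trans; [apply Rplus_le_compat; [exact IH|apply B]|].
      right. simpl. field. lra. }
  apply le_epsilon. intros eps E.
  apply (filterlim_locally_ball_norm (K := C_AbsRing) (U := C_NormedModule))
    with (eps := mkposreal eps E) in H.
  destruct H as [n0 H]. specialize (H (n0 + K)%nat ltac:(lia)).
  unfold ball_norm in H. rewrite sum_n_Csum in H.
  change (Cmod (Csum (seq 0 (S n0 + K)) c - s) < eps)%R in H.
  specialize (P (S n0)).
  assert (0 <= M / (1 - q) * q ^ (S n0 + K))%R.
  { apply Rmult_le_pos; [apply Rdiv_le_0_compat; lra|apply pow_le; lra]. }
  set (S1 := Csum (seq 0 (S n0 + K)) c) in *.
  replace (s - Csum (seq 0 K) c) with (S1 - Csum (seq 0 K) c + - (S1 - s))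
    by ring.
  eapply Rle_trans; [apply Cmod_triangle|]. rewrite Cmod_opp. lra.
Qed.

(** Abel's estimate. The constant [M] comes from convergence at the single
    point [x] and is the same for all [y], so the tail is small uniformly on
    each circle of radius smaller than [Cmod x]. *)
Lemma power_series_tail (c : nat -> C) (x t : C) :
  is_Cseries (fun k => c k * x ^ k) t ->
  exists M : R, forall (y s : C) (K : nat),
    (Cmod y < Cmod x)%R -> is_Cseries (fun k => c k * y ^ k) s ->
    (Cmod (s - Csum (seq 0 K) (fun k => c k * y ^ k)%C)
       <= M / (1 - Cmod y / Cmod x) * (Cmod y / Cmod x) ^ K)%R.
Proof.
  intros H. destruct (is_Cseries_bounded _ _ H) as [M B].
  exists M. intros y s K L.
  pose proof (Cmod_ge_0 y) as Y. assert (X : (0 < Cmod x)%R) by lra.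
  apply is_Cseries_geometric_tail.
  - split; [apply Rdiv_le_0_compat; lra|apply Rlt_div_l; lra].
  - intros k. specialize (B k). rewrite Cmod_mult, Cmod_pow in B. rewrite Cmod_mult, Cmod_pow.
    unfold Rdiv. rewrite Rpow_mult_distr, pow_inv.
    apply Rle_trans
      with (Cmod (c k) * Cmod x ^ k * (Cmod y ^ k * / Cmod x ^ k))%R.
    + right. field. apply pow_nonzero. lra.
    + apply Rmult_le_compat_r; [|exact B].
      apply Rdiv_le_0_compat; [now apply pow_le|now apply pow_lt].
Qed.

(** * Means over equally spaced points of a circle *)

Definition unit_root (N : nat) : C :=
  (cos (2 * PI / INR N), sin (2 * PI / INR N)).

Lemma unit_root_pow (N k : nat) :
  unit_root N ^ k =
  (cos (INR k * (2 * PI / INR N)), sin (INR k * (2 * PI / INR N))).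
Proof.
  induction k as [|k IH].
  - simpl. rewrite Rmult_0_l, cos_0, sin_0. reflexivity.
  - rewrite Cpow_S, IH, S_INR, Rmult_plus_distr_r, Rmult_1_l, cos_plus, sin_plus.
    unfold unit_root, Cmult. simpl. f_equal; ring.
Qed.

Lemma unit_root_pow_order (N : nat) : (0 < N)%nat -> unit_root N ^ N = 1.
Proof.
  intros HN. rewrite unit_root_pow.
  replace (INR N * (2 * PI / INR N))%R with (2 * PI)%R.
  - now rewrite cos_2PI, sin_2PI.
  - field. apply not_0_INR. lia.
Qed.

(** If [cos t = 1] then [sin (t / 2) = 0], impossible for
    [t = 2 pi k / N] strictly between [0] and [2 pi]. *)
Lemma unit_root_pow_neq_1 (N k : nat) :
  (0 < k < N)%nat -> unit_root N ^ k <> 1.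
Proof.
  intros Hk E. rewrite unit_root_pow in E.
  apply (f_equal fst) in E. simpl in E.
  pose proof PI_RGT_0 as P.
  assert (K : (0 < INR k)%R) by (apply lt_0_INR; lia).
  assert (KN : (INR k < INR N)%R) by (apply lt_INR; lia).
  replace (INR k * (2 * PI / INR N))%R with (2 * (INR k / INR N * PI))%R in E
    by (field; lra).
  rewrite cos_2a_sin in E.
  assert (Q : (0 < INR k / INR N < 1)%R).
  { split; [apply Rdiv_lt_0_compat; lra|apply Rlt_div_l; lra]. }
  assert (0 < sin (INR k / INR N * PI))%R by (apply sin_gt_0; nra).
  nra.
Qed.

Lemma Cmod_unit_root (N : nat) : Cmod (unit_root N) = 1%R.
Proof.
  unfold Cmod, unit_root. simpl fst. simpl snd.
  rewrite <- sqrt_1. f_equal.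
  pose proof (sin2_cos2 (2 * PI / INR N)). unfold Rsqr in *. lra.
Qed.

Lemma unit_root_neq_0 (N : nat) : unit_root N <> 0.
Proof. apply Cmod_gt_0. rewrite Cmod_unit_root. lra. Qed.

(** A Riemann sum, up to the factor [2 i pi], of the contour integral of
    [g w / w] over the circle of radius [r]. *)
Definition circle_mean (r : R) (N : nat) (g : C -> C) : C :=
  Csum (seq 0 N) (fun l => g (r * unit_root N ^ l)) / INR N.

Lemma INR_neq_0_C (N : nat) : (0 < N)%nat -> RtoC (INR N) <> 0.
Proof.
  intros H E. apply RtoC_inj in E. revert E. apply not_0_INR. lia.
Qed.

Lemma Csum_root_of_unity (z : C) (N : nat) :
  z <> 1 -> z ^ N = 1 -> Csum (seq 0 N) (fun l => z ^ l) = 0.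
Proof.
  intros Z1 ZN. rewrite geometric_Csum, ZN.
  - unfold Cdiv. ring.
  - intros E. apply Z1. rewrite <- (Cplus_0_l z), <- E. ring.
Qed.

Lemma unit_root_pow_pow_order (N k : nat) :
  (0 < N)%nat -> (unit_root N ^ k) ^ N = 1.
Proof.
  intros H. rewrite <- Cpow_mult_r, Nat.mul_comm, Cpow_mult_r.
  now rewrite unit_root_pow_order, Cpow_1_l.
Qed.

Lemma circle_mean_pow (r : R) (N k : nat) :
  (0 < k < N)%nat -> circle_mean r N (fun w => w ^ k) = 0.
Proof.
  intros Hk. unfold circle_mean.
  rewrite (Csum_ext_in _ _ (fun l => r ^ k * (unit_root N ^ k) ^ l)).
  2:{ intros l _. now rewrite Cpow_mult_l, <- !Cpow_mult_r, Nat.mul_comm. }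
  rewrite Csum_mult_l, Csum_root_of_unity.
  - unfold Cdiv. ring.
  - now apply unit_root_pow_neq_1.
  - apply unit_root_pow_pow_order. lia.
Qed.

Lemma circle_mean_inv_pow (r : R) (N k : nat) :
  (0 < r)%R -> (0 < k < N)%nat -> circle_mean r N (fun w => (/ w) ^ k) = 0.
Proof.
  intros Hr Hk.
  assert (R0 : RtoC r <> 0) by (intros E; apply RtoC_inj in E; lra).
  pose proof (Cpow_nz _ k (unit_root_neq_0 N)) as Z0.
  unfold circle_mean.
  rewrite (Csum_ext_in _ _ (fun l => (/ r) ^ k * (/ (unit_root N ^ k)) ^ l)).
  2:{ intros l _. pose proof (Cpow_nz _ l (unit_root_neq_0 N)) as L0.
      pose proof (Cpow_nz _ l Z0). pose proof (Cpow_nz _ k R0).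
      rewrite !Cpow_inv by (assumption || now apply Cmult_neq_0).
      rewrite Cpow_mult_l, <- Cpow_mult_r, (Nat.mul_comm l), Cpow_mult_r.
      field. now split. }
  rewrite Csum_mult_l, Csum_root_of_unity.
  - unfold Cdiv. ring.
  - intros E. apply (unit_root_pow_neq_1 N k Hk).
    transitivity (unit_root N ^ k * / (unit_root N ^ k)).
    + rewrite E. ring.
    + field. exact Z0.
  - rewrite Cpow_inv, unit_root_pow_pow_order by (exact Z0 || lia).
    field.
Qed.

Lemma circle_mean_const (r : R) (N : nat) (c : C) :
  (0 < N)%nat -> circle_mean r N (fun _ => c) = c.
Proof.
  intros H. unfold circle_mean. rewrite Csum_const, length_seq. field.
  now apply INR_neq_0_C.
Qed.

Lemma circle_mean_plus (r : R) (N : nat) (f g : C -> C) :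
  circle_mean r N (fun w => f w + g w) = circle_mean r N f + circle_mean r N g.
Proof. unfold circle_mean. rewrite Csum_plus. unfold Cdiv. ring. Qed.

Lemma circle_mean_Csum (r : R) (N : nat) (l : list nat) (c : nat -> C)
    (g : nat -> C -> C) :
  circle_mean r N (fun w => Csum l (fun k => c k * g k w)) =
  Csum l (fun k => c k * circle_mean r N (g k)).
Proof.
  unfold circle_mean, Cdiv. rewrite Csum_exchange, Cmult_comm, <- Csum_mult_l.
  apply Csum_ext_in. intros k _. rewrite Csum_mult_l. ring.
Qed.

Lemma circle_mean_close (r : R) (N : nat) (f g : C -> C) (M : R) :
  (0 < r)%R -> (0 < N)%nat ->
  (forall w, Cmod w = r -> (Cmod (f w - g w) <= M)%R) ->
  (Cmod (circle_mean r N f - circle_mean r N g) <= M)%R.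
Proof.
  intros Hr HN B.
  assert (N0 : (0 < INR N)%R) by now apply lt_0_INR.
  assert (D : circle_mean r N f - circle_mean r N g =
              circle_mean r N (fun w => f w - g w)).
  { assert (E : circle_mean r N f = circle_mean r N (fun w => f w - g w + g w)).
    { unfold circle_mean. f_equal. apply Csum_ext_in. intros l _. ring. }
    rewrite E, circle_mean_plus. ring. }
  rewrite D. unfold circle_mean.
  rewrite Cmod_div, Cmod_R, Rabs_pos_eq by (lra || now apply INR_neq_0_C).
  apply Rle_div_l; [exact N0|]. rewrite Rmult_comm.
  replace (INR N) with (INR (length (seq 0 N))) by now rewrite length_seq.
  apply Cmod_Csum_le.
  intros l _. apply B. rewrite Cmod_mult, Cmod_pow, Cmod_unit_root, pow1.
  rewrite Cmod_R, Rabs_pos_eq; lra.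
Qed.

(** With one more sample point than the largest exponent, no nonzero power is
    constant on the points: only the constant term survives the mean. *)
Lemma circle_mean_laurent_polynomial (r : R) (K : nat) (a b : nat -> C) :
  (0 < r)%R -> (0 < K)%nat ->
  circle_mean r (S K)
    (fun w => Csum (seq 0 K) (fun k => a k * w ^ S k) +
              Csum (seq 0 K) (fun k => b k * (/ w) ^ k)) = b 0%nat.
Proof.
  intros Hr HK.
  rewrite circle_mean_plus.
  rewrite (circle_mean_Csum r (S K) (seq 0 K) a (fun k w => w ^ S k)).
  rewrite (circle_mean_Csum r (S K) (seq 0 K) b (fun k w => (/ w) ^ k)).
  rewrite (Csum_ext_in (seq 0 K) _ (fun _ => 0)).
  2:{ intros k Hk. apply in_seq in Hk. rewrite circle_mean_pow by lia. ring. }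
  rewrite Csum_const. destruct K as [|K]; [lia|].
  change (seq 0 (S K)) with (0%nat :: seq 1 K). simpl Csum.
  rewrite (Csum_ext_in (seq 1 K) _ (fun _ => 0)).
  2:{ intros k Hk. apply in_seq in Hk.
      rewrite circle_mean_inv_pow by (lra || lia). ring. }
  rewrite Csum_const.
  change (fun w : C => (/ w) ^ 0) with (fun _ : C => RtoC 1).
  rewrite circle_mean_const by lia. ring.
Qed.

Lemma is_lim_seq_scal_geom (A q : R) :
  (0 <= q < 1)%R -> is_lim_seq (fun n => A * q ^ n)%R 0.
Proof.
  intros Q. replace (Finite 0) with (Rbar_mult A 0%R) by (simpl; f_equal; ring).
  apply is_lim_seq_scal_l. apply is_lim_seq_geom.
  rewrite Rabs_pos_eq; lra.
Qed.

(** * The residue is determined by the function *)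

(** Multiplying by [w] turns the coefficient of [1 / w] into a constant term.
    The nonnegative part is then a power series in [w], controlled from the
    outer point [r2]; the negative part is a power series in [/ w], controlled
    from the inner point [r1]. *)
Lemma circle_mean_residue (A : C -> Prop) (f : C -> C) (a : Z -> C)
    (r1 r r2 : R) :
  (0 < r1 < r)%R -> (r < r2)%R -> A r1 -> A r2 ->
  (forall w, Cmod w = r -> A w) -> laurent_expansion A f a ->
  filterlim (fun K => circle_mean r (S K) (fun w => w * f w)) eventually
    (locally (T := C_NormedModule) (a (-1)%Z)).
Proof.
  intros H1 H2 A1 A2 Ar L.
  pose (b := fun k => a (- Z.of_nat (k + 1))%Z).
  assert (Q : forall w q : C, w <> 0 ->
    is_Cseries (fun k => a (- Z.of_nat (k + 1))%Z / w ^ (k + 1)) q ->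
    is_Cseries (fun k => b k * (/ w) ^ k) (w * q)).
  { intros w q W T. refine (is_Cseries_ext _ _ _ _ _ eq_refl
                              (is_Cseries_mult_l w _ _ T)).
    intros k. fold (b k). rewrite Cpow_inv by exact W.
    rewrite Cpow_add_r, Cpow_1_r. field. split; [now apply Cpow_nz|exact W]. }
  assert (R1 : RtoC r1 <> 0) by (intros E; apply RtoC_inj in E; lra).
  destruct (L _ A2) as [p2 [_ [P2 _]]].
  destruct (L _ A1) as [_ [q1 [_ [Q1 _]]]].
  destruct (power_series_tail (fun k => a (Z.of_nat k)) r2 p2 P2) as [M TM].
  destruct (power_series_tail b (/ r1) _ (Q _ _ R1 Q1)) as [M' TM'].
  rewrite Cmod_R, Rabs_pos_eq in TM by lra.
  rewrite Cmod_inv, Cmod_R, Rabs_pos_eq in TM' by (exact R1 || lra).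
  pose (e := fun K : nat => (r * (M / (1 - r / r2)) * (r / r2) ^ K +
                  M' / (1 - / r / / r1) * (/ r / / r1) ^ K)%R).
  assert (I1 : (0 < / r < / r1)%R).
  { split; [apply Rinv_0_lt_compat; lra|apply Rinv_lt_contravar; nra]. }
  apply (filterlim_C_squeeze _ _ e).
  - exists 1%nat. intros K HK. change (a (-1)%Z) with (b 0%nat).
    rewrite <- (circle_mean_laurent_polynomial r K (fun k => a (Z.of_nat k)) b)
      by (lra || lia).
    apply circle_mean_close; [lra|lia|]. intros w Hw.
    assert (W : w <> 0) by (apply Cmod_gt_0; lra).
    destruct (L w (Ar w Hw)) as [p [q [P [Q' E]]]].
    rewrite E.
    specialize (TM w p K ltac:(lra) P).
    specialize (TM' (/ w) (w * q) K).
    rewrite Cmod_inv, Hw in TM' by exact W.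
    specialize (TM' ltac:(lra) (Q _ _ W Q')).
    rewrite Hw in TM.
    rewrite (Csum_ext_in _ (fun k => a (Z.of_nat k) * w ^ S k)
               (fun k => w * (a (Z.of_nat k) * w ^ k)))
      by (intros k _; rewrite Cpow_S; ring).
    rewrite Csum_mult_l.
    set (SP := Csum _ _) in *. set (SQ := Csum _ (fun k => b k * _)) in *.
    replace (w * (p + q) - (w * SP + SQ))
      with (w * (p - SP) + (w * q - SQ)) by ring.
    eapply Rle_trans; [apply Cmod_triangle|].
    rewrite Cmod_mult, Hw. unfold e. apply Rplus_le_compat; [|exact TM'].
    rewrite Rmult_assoc. apply Rmult_le_compat_l; [lra|exact TM].
  - replace (Finite 0) with (Finite (0 + 0)) by (f_equal; ring).
    apply is_lim_seq_plus'; apply is_lim_seq_scal_geom.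
    + split; [apply Rdiv_le_0_compat; lra|apply Rlt_div_l; lra].
    + split; [apply Rdiv_le_0_compat; lra|apply Rlt_div_l; lra].
Qed.

Lemma laurent_residue_unique (A : C -> Prop) (f : C -> C) (a b : Z -> C)
    (r1 r r2 : R) :
  (0 < r1 < r)%R -> (r < r2)%R -> A r1 -> A r2 ->
  (forall w, Cmod w = r -> A w) ->
  laurent_expansion A f a -> laurent_expansion A f b -> a (-1)%Z = b (-1)%Z.
Proof.
  intros H1 H2 A1 A2 Ar La Lb.
  apply (filterlim_locally_unique (K := C_AbsRing) (V := C_NormedModule)
           (F := eventually)
           (fun K => circle_mean r (S K) (fun w => w * f w)));
    eapply circle_mean_residue; eassumption.
Qed.

(** * The function [x1] on an annulus *)

Lemma ex_derive_inv_minus (c w : C) :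
  w - c <> 0 ->
  ex_derive (K := C_AbsRing) (V := C_NormedModule) (fun z => 1 / (z - c)) w.
Proof.
  intros H. eexists.
  apply (is_derive_ext (K := C_AbsRing) (V := C_NormedModule)
           (fun z => / (z - c))); [intros t; unfold Cdiv; symmetry; apply Cmult_1_l|].
  apply (is_derive_comp (K := C_AbsRing) (V := C_NormedModule)
           Cinv (fun z => z - c)).
  - now apply is_derive_Cinv.
  - apply (is_derive_minus (K := C_AbsRing) (V := AbsRing_NormedModule C_AbsRing)).
    + apply (is_derive_id (K := C_AbsRing)).
    + apply (is_derive_const (K := C_AbsRing) (V := AbsRing_NormedModule C_AbsRing)).
Qed.

Lemma ex_derive_Csum (l : list nat) (g : nat -> C -> C) (w : C) :
  (forall j, In j l ->
     ex_derive (K := C_AbsRing) (V := C_NormedModule) (g j) w) ->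
  ex_derive (K := C_AbsRing) (V := C_NormedModule)
    (fun z => Csum l (fun j => g j z)) w.
Proof.
  induction l as [|i l IH]; intros H; simpl.
  - apply (ex_derive_const (K := C_AbsRing) (V := C_NormedModule)).
  - apply (ex_derive_plus (K := C_AbsRing) (V := C_NormedModule)).
    + apply H. now left.
    + apply IH. intros j Hj. apply H. now right.
Qed.

Lemma x1_Csum (m : nat) (delta : nat -> C) (w : C) :
  (1 <= m)%nat -> delta 1%nat = 0 ->
  x1 m delta w = Csum (seq 1 m) (fun j => 1 / (w - delta j)).
Proof.
  intros Hm D. destruct m as [|m]; [lia|].
  unfold x1. simpl. rewrite D, Nat.sub_0_r.
  now replace (w - 0) with w by ring.
Qed.

Lemma Cmod_monotone (m : nat) (delta : nat -> C) :
  (forall j : nat, (1 <= j < m)%nat ->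
     (Cmod (delta j) < Cmod (delta (S j)))%R) ->
  forall i j : nat, (1 <= i <= j)%nat -> (j <= m)%nat ->
    (Cmod (delta i) <= Cmod (delta j))%R.
Proof.
  intros H i j Hij. induction j as [|j IH]; intros Hj; [lia|].
  destruct (Nat.eq_dec i (S j)) as [->|N]; [lra|].
  specialize (IH ltac:(lia) ltac:(lia)). specialize (H j ltac:(lia)). lra.
Qed.

Lemma annulus_poles (m : nat) (delta : nat -> C) (n : nat) (w : C) :
  (forall j : nat, (1 <= j < m)%nat ->
     (Cmod (delta j) < Cmod (delta (S j)))%R) ->
  (1 <= n <= m)%nat -> annulus m delta n w ->
  (forall j, In j (seq 1 n) -> (Cmod (delta j) < Cmod w)%R) /\
  (forall j, In j (seq (S n) (m - n)) -> (Cmod w < Cmod (delta j))%R).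
Proof.
  intros H Hn [Lo Hi]. unfold radius in Lo, Hi.
  rewrite (proj2 (Nat.leb_le n m)) in Lo by lia. simpl in Lo.
  split; intros j Hj; apply in_seq in Hj.
  - pose proof (Cmod_monotone m delta H j n ltac:(lia) ltac:(lia)). lra.
  - rewrite (proj2 (Nat.leb_le (S n) m)) in Hi by lia. simpl in Hi.
    pose proof (Cmod_monotone m delta H (S n) j ltac:(lia) ltac:(lia)). lra.
Qed.

(** The annulus must have room on both sides of a circle, because the residue
    of a Laurent expansion is read off from convergence at three radii. *)
Lemma annulus_contains_closed (m : nat) (delta : nat -> C) (n : nat) :
  (forall j : nat, (1 <= j < m)%nat ->
     (Cmod (delta j) < Cmod (delta (S j)))%R) ->
  (1 <= n <= m)%nat ->
  exists r1 r2 : R, (0 < r1 < r2)%R /\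
    forall w, (r1 <= Cmod w <= r2)%R -> annulus m delta n w.
Proof.
  intros H Hn. pose proof (Cmod_ge_0 (delta n)) as P.
  unfold annulus, radius. rewrite (proj2 (Nat.leb_le n m)) by lia.
  destruct (Nat.leb_spec (S n) m) as [L|L].
  - specialize (H n ltac:(lia)).
    exists ((2 * Cmod (delta n) + Cmod (delta (S n))) / 3)%R,
           ((Cmod (delta n) + 2 * Cmod (delta (S n))) / 3)%R.
    split; [lra|]. intros w W. simpl. lra.
  - exists (Cmod (delta n) + 1)%R, (Cmod (delta n) + 2)%R.
    split; [lra|]. intros w W. simpl. split; [lra|exact I].
Qed.

Lemma index_sets_annulus (m : nat) (delta : nat -> C) (n : nat) (w : C) :
  (forall j : nat, (1 <= j < m)%nat ->
     (Cmod (delta j) < Cmod (delta (S j)))%R) ->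
  (1 <= n <= m)%nat -> annulus m delta n w ->
  I_in m delta w = seq 2 (n - 1) /\ I_out m delta w = seq (S n) (m - n).
Proof.
  intros H Hn Aw.
  destruct (annulus_poles m delta n w H Hn Aw) as [In1 Out1].
  unfold I_in, I_out.
  replace (m - 1)%nat with (n - 1 + (m - n))%nat by lia.
  rewrite seq_app, !filter_app.
  replace (2 + (n - 1))%nat with (S n) by lia.
  split.
  - rewrite (filter_ext_in _ (fun _ => true) (seq 2 (n - 1))).
    2:{ intros j Hj. unfold Rltb. destruct Rlt_dec as [_|F]; [reflexivity|].
        exfalso. apply F, In1. apply in_seq in Hj. apply in_seq. lia. }
    rewrite (filter_ext_in _ (fun _ => false) (seq (S n) (m - n))).
    2:{ intros j Hj. unfold Rltb. destruct Rlt_dec as [F|_]; [|reflexivity].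
        specialize (Out1 j Hj). lra. }
    now rewrite List.filter_true, List.filter_false, app_nil_r.
  - rewrite (filter_ext_in _ (fun _ => false) (seq 2 (n - 1))).
    2:{ intros j Hj. unfold Rltb. destruct Rlt_dec as [F|_]; [|reflexivity].
        assert (J : In j (seq 1 n)) by (apply in_seq in Hj; apply in_seq; lia).
        specialize (In1 j J). lra. }
    rewrite (filter_ext_in _ (fun _ => true) (seq (S n) (m - n))).
    2:{ intros j Hj. unfold Rltb. destruct Rlt_dec as [_|F]; [reflexivity|].
        exfalso. now apply F, Out1. }
    now rewrite List.filter_true, List.filter_false.
Qed.

Lemma x1_split (m : nat) (delta : nat -> C) (n : nat) (w : C) :
  delta 1%nat = 0 ->
  (forall j : nat, (1 <= j < m)%nat ->
     (Cmod (delta j) < Cmod (delta (S j)))%R) ->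
  (1 <= n <= m)%nat -> annulus m delta n w ->
  x1 m delta w =
  Csum (seq 1 n) (fun j => 1 / (w - delta j)) -
  Csum (seq (S n) (m - n)) (fun j => 1 / (delta j - w)).
Proof.
  intros D1 H Hn Aw.
  destruct (annulus_poles m delta n w H Hn Aw) as [_ Out1].
  rewrite x1_Csum by (lia || exact D1).
  replace m with (n + (m - n))%nat at 1 by lia.
  rewrite seq_app, Csum_app.
  rewrite (Csum_ext_in (seq (1 + n) (m - n)) _
             (fun j => -1 * (1 / (delta j - w)))).
  - rewrite Csum_mult_l. change (1 + n)%nat with (S n). ring.
  - intros j Hj. pose proof (Cmod_lt_neq _ _ (Out1 j Hj)) as N.
    field. split; [exact N|].
    intros E. apply N. replace (delta j - w) with (- (w - delta j)) by ring.
    rewrite E. ring.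
Qed.

(** The coefficient of [w ^ z]. For negative [z] the sum runs over all inner
    poles including [delta 1 = 0], whose only contribution is [0 ^ 0 = 1] at
    [z = -1]. *)
Definition x1_coef (m : nat) (delta : nat -> C) (n : nat) (z : Z) : C :=
  if (0 <=? z)%Z
  then - Csum (seq (S n) (m - n)) (fun j => 1 / delta j ^ (Z.to_nat z + 1))
  else Csum (seq 1 n) (fun j => delta j ^ (Z.to_nat (- z) - 1)).

Lemma x1_laurent_expansion (m : nat) (delta : nat -> C) (n : nat) :
  delta 1%nat = 0 ->
  (forall j : nat, (1 <= j < m)%nat ->
     (Cmod (delta j) < Cmod (delta (S j)))%R) ->
  (1 <= n <= m)%nat ->
  laurent_expansion (annulus m delta n) (x1 m delta) (x1_coef m delta n).
Proof.
  intros D1 H Hn w Aw.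
  destruct (annulus_poles m delta n w H Hn Aw) as [In1 Out1].
  exists (-1 * Csum (seq (S n) (m - n)) (fun j => 1 / (delta j - w))),
         (Csum (seq 1 n) (fun j => 1 / (w - delta j))).
  split; [|split].
  - refine (is_Cseries_ext _ _ _ _ _ eq_refl
      (is_Cseries_mult_l (-1) _ _
         (is_Cseries_Csum _ (fun j k => w ^ k / delta j ^ (k + 1)) _ _))).
    + intros k. unfold x1_coef.
      rewrite (proj2 (Z.leb_le 0 (Z.of_nat k))), Nat2Z.id by lia.
      rewrite (Csum_ext_in _ _ (fun j => w ^ k * (1 / delta j ^ (k + 1))))
        by (intros j _; unfold Cdiv; ring).
      rewrite Csum_mult_l. ring.
    + intros j Hj. now apply is_Cseries_inv_minus, Out1.
  - refine (is_Cseries_ext _ _ _ _ _ eq_refl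
      (is_Cseries_Csum _ (fun j k => delta j ^ k / w ^ (k + 1)) _ _)).
    + intros k. unfold x1_coef.
      rewrite (proj2 (Z.leb_gt 0 (- Z.of_nat (k + 1)))) by lia.
      replace (Z.to_nat (- - Z.of_nat (k + 1)) - 1)%nat with k by lia.
      rewrite (Csum_ext_in _ _ (fun j => / w ^ (k + 1) * delta j ^ k))
        by (intros j _; unfold Cdiv; ring).
      rewrite Csum_mult_l. unfold Cdiv. ring.
    + intros j Hj. now apply is_Cseries_inv_minus, In1.
  - rewrite (x1_split m delta n) by assumption. ring.
Qed.

Theorem proposition5p1 (m : nat) (delta : nat -> C)
    (hm : (1 <= m)%nat)
    (hdelta1 : delta 1%nat = 0)
    (hdelta : forall j : nat, (1 <= j < m)%nat ->
       (Cmod (delta j) < Cmod (delta (S j)))%R)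
    (n : nat) (hn : (1 <= n <= m)%nat) :
  exists Iin Iout : list nat,
    (forall w, annulus m delta n w ->
       I_in m delta w = Iin /\ I_out m delta w = Iout) /\
    (exists H : C -> C,
       holomorphic_on (annulus m delta n) H /\
       (forall w, annulus m delta n w ->
          x1 m delta w = INR n / w + H w /\
          H_expansion delta Iin Iout w (H w))) /\
    (exists a : Z -> C, laurent_expansion (annulus m delta n) (x1 m delta) a) /\
    (forall a : Z -> C, laurent_expansion (annulus m delta n) (x1 m delta) a ->
       a (-1)%Z = INR n) /\
    n = (1 + length Iin)%nat.
Proof.
  pose proof (x1_laurent_expansion m delta n hdelta1 hdelta hn) as L.
  exists (seq 2 (n - 1)), (seq (S n) (m - n)).
  split; [intros w; now apply index_sets_annulus|].
  split; [|split; [now eexists; exact L|split]].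
  (* The term n / w is written as n copies of the pole at delta 1 = 0, so that
     H is a difference of two sums of simple poles. *)
  - exists (fun w => Csum (seq 1 m) (fun j => 1 / (w - delta j))
                     - Csum (seq 1 n) (fun _ => 1 / (w - delta 1%nat))).
    split; [intros w Aw|intros w Aw; split].
    + destruct (annulus_poles m delta n w hdelta hn Aw) as [In1 Out1].
      assert (N : forall j, In j (seq 1 m) -> w - delta j <> 0).
      { intros j Hj. replace m with (n + (m - n))%nat in Hj by lia.
        rewrite seq_app in Hj. apply in_app_or in Hj. destruct Hj as [Hj|Hj].
        - now apply Cmod_lt_neq, In1.
        - intros E. apply (Cmod_lt_neq _ _ (Out1 j Hj)).
          replace (delta j - w) with (- (w - delta j)) by ring.
          rewrite E. ring. }
      apply (ex_derive_minus (K := C_AbsRing) (V := C_NormedModule)).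
      * apply ex_derive_Csum. intros j Hj. now apply ex_derive_inv_minus, N.
      * apply ex_derive_Csum. intros _ _. apply ex_derive_inv_minus, N.
        apply in_seq. lia.
    + rewrite x1_Csum by assumption.
      rewrite Csum_const, length_seq, hdelta1.
      replace (w - 0) with w by ring. unfold Cdiv. ring.
    + destruct (annulus_poles m delta n w hdelta hn Aw) as [In1 Out1].
      exists (fun j => 1 / (w - delta j) - 1 / w), (fun j => 1 / (delta j - w)).
      split; [|split].
      * intros j Hj. apply is_Cseries_inv_minus_tail, In1.
        apply in_seq in Hj. apply in_seq. lia.
      * intros j Hj. now apply is_Cseries_inv_minus, Out1.
      * pose proof (x1_split m delta n w hdelta1 hdelta hn Aw) as E.
        rewrite x1_Csum in E by assumption. rewrite E, Csum_const, length_seq.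
        destruct n as [|n]; [lia|].
        change (seq 1 (S n)) with (1%nat :: seq 2 n). simpl Csum at 1.
        replace (S n - 1)%nat with n by lia.
        change (fun j => 1 / (w - delta j) - 1 / w)
          with (fun j => 1 / (w - delta j) + - (1 / w)).
        rewrite (Csum_plus (seq 2 n) (fun j => 1 / (w - delta j))
                   (fun _ => - (1 / w))), Csum_const, length_seq.
        rewrite hdelta1, S_INR, RtoC_plus.
        replace (w - 0) with w by ring. ring.
  - intros a La.
    destruct (annulus_contains_closed m delta n hdelta hn)
      as [r1 [r2 [Hr Ar]]].
    transitivity (x1_coef m delta n (-1)).
    2:{ unfold x1_coef. simpl. rewrite Csum_const, length_seq. ring. }
    apply (laurent_residue_unique (annulus m delta n) (x1 m delta) _ _
             r1 ((r1 + r2) / 2) r2); [| | | | |exact La|exact L].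
    + lra.
    + lra.
    + apply Ar. rewrite Cmod_R, Rabs_pos_eq; lra.
    + apply Ar. rewrite Cmod_R, Rabs_pos_eq; lra.
    + intros w Hw. apply Ar. lra.
  - rewrite length_seq. lia.
Qed.
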